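(* Let $p$ be an arbitrary positive integer, let $\tau(t)$ be the tau function of a KP operator $L$ satisfying both the $p$-reduced KP hierarchy and the string equation, and for $k=-1,0,1,\dots$, $i\in\mathbb N$ let $c_k^{(i)}$ be the constant for which $\bar P_{kp}^{(i)}\cdot\tau=c_k^{(i)}\cdot\tau$ (one has $c_k^{(i)}=0$ for $k\ge1$). Then the algebra $$P=\{\bar P^{(i)}_{-p}-c_{-1}^{(i)},\ \bar P^{(i)}_0-c_0^{(i)},\ \bar P^{(i)}_{kp}\ \mid\ i,k\in\mathbb N\}$$ includes a Virasoro algebra with no center as its subalgebra, that is, $\{\bar P_{np}^{(2)}-c_n^{(2)}\}$, $n=-1,0,1,2,\dots$.
   Context: $\mathbb N=\{1,2,\dots\}$. Functions depend on infinitely many times $t=(t_1,t_2,\dots)$, $\partial=\partial_{t_1}$; for a formal pseudodifferential operator $R=\sum_{j\le d}f_j\partial^j$ put $R_+=\sum_{j\ge0}f_j\partial^j$, $R_-=\sum_{j<0}f_j\partial^j$. The KP hierarchy for $L=\partial+\sum_{j\ge1}f_j(t)\partial^{-j}$ is $\partial L/\partial t_i=[(L^i)_+,L]$. The dressing operator $\Phi=1+\sum_{j\ge1}w_j(t)\partial^{-j}$ satisfies $L=\Phi\partial\Phi^{-1}$ and $\partial\Phi/\partial t_i=-(L^i)_-\Phi$. The wave function is $w(t,z)=\Phi\exp(\sum_{i\ge1}t_iz^i)$, and the tau function $\tau(t)$ is the function with $w(t,z)=\frac{\tau(t-[z^{-1}])}{\tau(t)}\exp(\sum_i t_iz^i)$,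 where $[z]=(z,z^2/2,z^3/3,\dots)$. Put $M=\Phi\,\Gamma\,\Phi^{-1}$ with $\Gamma=\sum_{i\ge1}it_i\partial^{i-1}$. The additional symmetries act by $\partial^*_{ml}\Phi=-(M^mL^l)_-\Phi$. ''$p$-reduced KP hierarchy'' means that $L$ satisfies the KP hierarchy and $(L^p)_-=0$; the tau function is then independent of $t_p,t_{2p},t_{3p},\dots$. The string equation is $[L^p,\frac1p(ML^{-p+1})_+]=1$, or equivalently $\partial^*_{1,-p+1}L=0$. Let $P_i=\partial_{t_i}$ for $i>0$, $P_i=|i|\,t_{|i|}$ for $i\le0$ (so $P_0=0$), and let $:\ :$ denote normal ordering ($P_i$ with $i\le0$ to the left of those with $i>0$). Let $X(\lambda,\mu)=:\exp\sum_{i\ne0}\big(\frac{P_i}{i\lambda^i}-\frac{P_i}{i\mu^i}\big):$ and define $W_n^{(m)}$ by $\sum_{n\in\mathbb Z}\lambda^{-n-m}W_n^{(m)}=\partial_\mu^m|_{\mu=\lambda}X(\lambda,\mu)$. The operators $P_n^{(i)}$ are $P_n^{(1)}=P_n$, $P_n^{(2)}=\sum_{a+b=n}:P_aP_b:$, $P_n^{(3)}=\sum_{a+b+c=n}:P_aP_bP_c:$, $P_n^{(4)}=\sum_{a+b+c+d=n}:P_aP_bP_cP_d:-\sum_{a+b=n}:abP_aP_b:$, and so on; they are related to the $W$'s by $W_{kp}^{(i)}=P_{kp}^{(i)}+\text{const}\cdot P_{kp}^{(i-1)}+\dots+\text{const}\cdot P_{kp}^{(1)}$, and conversely with the roles of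 $P$ and $W$ exchanged. $\bar P_{kp}^{(i)}$ denotes $P_{kp}^{(i)}|_{t_{mp}=0,\ m\in\mathbb N}$, i.e. the sum of those normally ordered terms of $P_{kp}^{(i)}$ containing none of the variables $t_{mp}$, $m\in\mathbb N$. Under the hypotheses on $\tau$, it is known that $\bar P_{kp}^{(i)}\cdot\tau=c_k^{(i)}\cdot\tau$ with constants $c_k^{(i)}$ for $k=-1,0,1,\dots$, $i\in\mathbb N$, and that $c_k^{(i)}=0$ for $k\ge1$. *)

(* Defs.v *)
(* MathComp with the classical layer of MathComp-Analysis.

   Conventions
   - A function of t = (t_1, t_2, ...) is a formal power series in the shifted
     times s_i = t_i - b_i around a finitely supported base point b, with
     coefficients in a numFieldType K.  An arbitrary b is needed: for p >= 2 the
     string equation has no solution that is regular at t = 0.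
   - Index i : nat stands for the time t_(i+1); so {mset nat} is the set of
     monomials in s_1, s_2, ...
   - \sum_(x \in A) F x is the sum over the x in A where F x != 0.  All the
     infinite sums below are taken coefficientwise; for the operators occurring
     in the theory only finitely many terms contribute to each coefficient. *)
From HB Require Import structures.
From mathcomp Require Import all_boot all_order all_algebra.
From mathcomp Require Import finmap multiset.
From mathcomp Require Import boolp classical_sets functions cardinality fsbigop.

Set Implicit Arguments.
Unset Strict Implicit.
Unset Printing Implicit Defensive.

Import Order.TTheory GRing.Theory Num.Theory.

Local Open Scope mset_scope.
Local Open Scope classical_set_scope.
Local Open Scope ring_scope.

Definition series (K : numFieldType) : Type := {mset nat} -> K^o.
HB.instance Definition _ (K : numFieldType) :=
  GRing.Lmodule.copy (series K) ({mset nat} -> K^o).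

(* R : psd K is the formal sum of the R j * d^j, j in Z, where d = d/dt_1.
   It is unbounded in both directions because Gamma, hence M, has infinite
   order. *)
Definition psd (K : numFieldType) : Type := int -> series K.
HB.instance Definition _ (K : numFieldType) :=
  GRing.Lmodule.copy (psd K) (int -> series K).

Section PowerSeries.
Variable K : numFieldType.
Implicit Types f g : series K.

Definition smul f g : series K :=
  fun m => \sum_(l \in [set l | msubset l m]) f l * g (msetB m l).

Definition sone : series K := fun m => (m == mset0)%:R.

Definition pd (i : nat) f : series K :=
  fun m => (m i).+1%:R * f (msetD m (msetn 1 i)).

(* t_(i+1) = b_(i+1) + s_(i+1) *)
Definition tvar (b : nat -> K) (i : nat) : series K :=
  fun m => if m == mset0 then b i else (m == msetn 1 i)%:R.

Definition weight (m : {mset nat}) : nat := (\sum_(i <- m) i.+1)%N.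

(* The coefficient of z^-j in f(t - [z^-1]), i.e. after the substitution
   s_i -> s_i - z^-i / i. *)
Definition shift_coef (j : nat) f : series K := fun m =>
  \sum_(l \in [set l | weight l = j])
    f (msetD m l) *
    \prod_(i <- finsupp l) ('C(m i + l i, l i)%:R * (- i.+1%:R^-1) ^+ l i).

End PowerSeries.

Section PseudoDifferential.
Variable K : numFieldType.
Implicit Types R S : psd K.

Definition binomz (a : int) (n : nat) : K :=
  \prod_(k < n) (a%:~R - k%:R) / n`!%:R.

(* (f d^i) (g d^j) = sum_n binomial(i, n) f g^(n) d^(i+j-n) *)
Definition pmul R S : psd K := fun k m =>
  \sum_(x \in [set: int * nat])
    binomz x.1 x.2 *
    smul (R x.1) (iter x.2 (pd 0) (S (k - x.1 + x.2%:Z))) m.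

Definition pdelta (i : int) : psd K := fun k => if k == i then sone K else 0.

Definition ppow R (n : nat) : psd K := iter n (pmul R) (pdelta 0).

Definition pcomm R S : psd K := pmul R S - pmul S R.

Definition pplus R : psd K := fun k => if 0 <= k then R k else 0.
Definition pminus R : psd K := fun k => if k < 0 then R k else 0.

Definition order_le (d : int) R := forall k, d < k -> R k = 0.

Definition pinverse R S :=
  [/\ exists d, order_le d S, pmul R S = pdelta 0 & pmul S R = pdelta 0].

(* d/dt_(i+1) of the coefficients *)
Definition ppd (i : nat) R : psd K := fun k => pd i (R k).

Definition is_lax L := [/\ order_le 1 L, L 1 = sone K & L 0 = 0].

Definition is_dressing Phi := order_le 0 Phi /\ Phi 0 = sone K.

Definition KP_hierarchy L :=
  forall i : nat, ppd i L = pcomm (pplus (ppow L i.+1)) L.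

(* PhiV is Phi^-1 *)
Definition dressing_of Phi PhiV L :=
  [/\ is_dressing Phi, pinverse Phi PhiV,
      L = pmul (pmul Phi (pdelta 1)) PhiV &
      forall i : nat, ppd i Phi = - pmul (pminus (ppow L i.+1)) Phi].

Definition reduced (p : nat) L := pminus (ppow L p) = 0.

Definition Gamma (b : nat -> K) : psd K :=
  fun k => if k is Posz j then j.+1%:R *: tvar b j else 0.

Definition opM (b : nat -> K) Phi PhiV : psd K :=
  pmul (pmul Phi (Gamma b)) PhiV.

(* [L^p, (1/p) (M L^(-p+1))_+] = 1, where LV is L^-1 *)
Definition string_equation (p : nat) (b : nat -> K) Phi PhiV L LV :=
  pcomm (ppow L p)
    (p%:R^-1 *: pplus (pmul (opM b Phi PhiV) (ppow LV p.-1))) = pdelta 0.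

(* w(t,z) = Phi exp(sum_i t_i z^i) = (sum_j w_j z^-j) exp(sum_i t_i z^i), where
   w_j is the coefficient of d^-j in Phi; the quotient
   tau(t - [z^-1]) / tau(t) = sum_j w_j z^-j is written without denominator. *)
Definition is_tau Phi (tau : series K) :=
  tau <> 0 /\
  forall j : nat, shift_coef j tau = smul tau (Phi (- j%:Z)).

End PseudoDifferential.

Definition op (K : numFieldType) : Type := series K -> series K.
HB.instance Definition _ (K : numFieldType) :=
  GRing.Lmodule.copy (op K) (series K -> series K).

(* A symbol k is the normally ordered expression
     sum over words a_1 ... a_j of k(a_1 ... a_j) :P_(a_1) ... P_(a_j): *)
Definition symbol (K : numFieldType) : Type := seq int -> K^o.
HB.instance Definition _ (K : numFieldType) :=
  GRing.Lmodule.copy (symbol K) (seq int -> K^o).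

Section Operators.
Variable K : numFieldType.
Implicit Types (f : series K) (k : symbol K).

Definition Pmode (b : nat -> K) (a : int) : op K := fun f =>
  match a with
  | Posz 0 => 0
  | Posz i.+1 => pd i f
  | Negz i => i.+1%:R *: smul (tvar b i) f
  end.

Definition normal_product (b : nat -> K) (w : seq int) : op K := fun f =>
  foldr (Pmode b) (foldr (Pmode b) f [seq a <- w | 0 < a]) [seq a <- w | a <= 0].

Definition op_of (b : nat -> K) k : op K := fun f m =>
  \sum_(w \in [set: seq int]) k w * normal_product b w f m.

(* As P_0 = 0, words with a letter 0 are given coefficient 0 throughout. *)
Definition has_mode (n : int) (w : seq int) : bool :=
  all (fun a => a != 0) w && (\sum_(a <- w) a == n).

(* dXmu m w e is the m-th derivative with respect to mu at mu = 1 of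
   mu^e * prod_(a <- w) (1 - mu^-a) / a. *)
Fixpoint dXmu (m : nat) (w : seq int) (e : int) : K :=
  if w is a :: w' then (dXmu m w' e - dXmu m w' (e - a)) / a%:~R
  else \prod_(i < m) (e%:~R - i%:R).

(* The coefficient of :P_(a_1) ... P_(a_j): in X(lambda,mu) is
   1/j! prod_i (lambda^-a_i - mu^-a_i) / a_i; its m-th mu-derivative at
   mu = lambda is lambda^(-n-m), n = a_1 + ... + a_j, times the value at
   lambda = 1. *)
Definition Wsymbol (m : nat) (n : int) : symbol K := fun w =>
  if has_mode n w then dXmu m w 0 / (size w)`!%:R else 0.

Definition Psymbol1 (n : int) : symbol K := fun w =>
  if has_mode n w then (if w is [:: _] then 1 else 0) else 0.
Definition Psymbol2 (n : int) : symbol K := fun w =>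
  if has_mode n w then (if w is [:: _; _] then 1 else 0) else 0.
Definition Psymbol3 (n : int) : symbol K := fun w =>
  if has_mode n w then (if w is [:: _; _; _] then 1 else 0) else 0.
Definition Psymbol4 (n : int) : symbol K := fun w =>
  if has_mode n w then
    match w with
    | [:: _; _; _; _] => 1
    | [:: a; c] => - (a * c)%:~R
    | _ => 0
    end
  else 0.

(* The P_n^(i) are explicit for i <= 4; beyond that they are determined by the
   W_n^(i) only up to a triangular change with constant coefficients, which
   does not affect the algebra that they generate.  The relation is stated in
   one direction: it is unitriangular, so the converse one follows. *)
Definition is_P_family (P : nat -> int -> symbol K) :=
  [/\ forall n, P 1%N n = Psymbol1 n,
      forall n, P 2%N n = Psymbol2 n,
      forall n, P 3%N n = Psymbol3 n,
      forall n, P 4%N n = Psymbol4 n &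
      forall (i : nat) (n : int), (0 < i)%N -> exists q : nat -> K,
        Wsymbol i n = P i n + \sum_(1 <= j < i) q j *: P j n].

(* Setting t_p, t_2p, ... to zero: the normally ordered terms involving one of
   the t_(mp), as a factor or through d/dt_(mp), are dropped. *)
Definition reduce (p : nat) k : symbol K := fun w =>
  if all (fun a => ~~ (p %| `|a|)%N) w then k w else 0.

Definition bracket (A B : op K) : op K := fun f => A (B f) - B (A f).

Definition lie_closed (G : set (op K)) :=
  [/\ G 0, forall (x : K) A B, G A -> G B -> G (x *: A + B) &
      forall A B, G A -> G B -> G (bracket A B)].

Definition lie_generated (S : set (op K)) : set (op K) := smallest lie_closed S.

(* Pbar p b P i n is the operator \bar P_(np)^(i) *)
Definition Pbar (p : nat) (b : nat -> K) (P : nat -> int -> symbol K)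
    (i : nat) (n : int) : op K :=
  op_of b (reduce p (P i (n * p%:Z))).

Definition P_generators (p : nat) (b : nat -> K) (P : nat -> int -> symbol K)
    (c : int -> nat -> K) : set (op K) :=
  [set A | exists i : nat, (0 < i)%N /\
     [\/ A = Pbar p b P i (-1) - c (-1) i *: idfun,
         A = Pbar p b P i 0 - c 0 i *: idfun |
         exists k : nat, (0 < k)%N /\ A = Pbar p b P i k%:Z]].

Definition P_algebra (p : nat) (b : nat -> K) (P : nat -> int -> symbol K)
    (c : int -> nat -> K) : set (op K) :=
  lie_generated (P_generators p b P c).

(* The relations of the centreless Virasoro algebra, for n >= -1. *)
Definition centerless_virasoro (l : int -> op K) :=
  forall m n : int, -1 <= m -> -1 <= n ->
    bracket (l m) (l n) = (m - n)%:~R *: l (m + n).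

Definition independent_from_m1 (l : int -> op K) :=
  forall (N : nat) (x : 'I_N -> K),
    \sum_(j < N) x j *: l (j%:Z - 1) = 0 -> forall j, x j = 0.

End Operators.

(* Main.v *)
(* Write L_n for \bar P_(np)^(2), as an operator, not only on tau.  It is a
   locally finite sum of products of modes, and
     [L_n, P_a] = -2a P_(np+a) if p does not divide a, and 0 otherwise.
   By the Jacobi identity [L_m, L_n] - 2p(m-n) L_(m+n) then commutes with every
   mode P_a, so it is a scalar because the Heisenberg algebra acts irreducibly
   on power series.  Applying it to tau, a common eigenvector, identifies the
   scalar as -2p(m-n) c_(m+n): subtracting the eigenvalues is exactly what
   removes the centre.  For m, n >= 0 the scalar vanishes since L_m and L_n kill
   the constant 1; taking n = 0 yields c_m = 0 for m >= 1. *)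
Require Import Defs.
From HB Require Import structures.
From mathcomp Require Import all_boot all_order all_algebra.
From mathcomp Require Import finmap multiset.
From mathcomp Require Import boolp classical_sets functions cardinality fsbigop.
From mathcomp Require Import zify ring.

Import Order.TTheory GRing.Theory Num.Theory.
Local Open Scope ring_scope.

(** * Modes acting on power series and the Heisenberg relations *)

Section Heisenberg.
Set Implicit Arguments.
Unset Strict Implicit.
Local Open Scope mset_scope.
Local Open Scope ring_scope.
Variable K : numFieldType.
Implicit Types (f g : series K) (b : nat -> K) (m l : {mset nat}) (i j : nat).

(** Lets a sum over a set be computed along any list covering its support; the list may also contain
    points where [F] vanishes. *)
Lemma fsum_seq (V : nmodType) (T : choiceType) (A : set T) (r : seq T)
    (F : T -> V) :
    uniq r -> (forall t, t \in r -> A t) ->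
    (forall t, A t -> t \notin r -> F t = 0) ->
  \sum_(t \in A) F t = \sum_(t <- r) F t.
Proof.
move=> ur rA F0; rewrite (fsbigE r) // big_seq_cond [RHS]big_seq.
by apply: eq_bigl => t; case: (boolP (t \in r)) => //= /rA At; rewrite mem_set.
Qed.

Lemma series_lcombE (x : K) f g m : (x *: f + g) m = x * f m + g m.
Proof. by []. Qed.

Lemma series_addE f g m : (f + g) m = f m + g m.
Proof. by []. Qed.

Lemma series_oppE f m : (- f) m = - f m.
Proof. by []. Qed.

Lemma series_scaleE (x : K) f m : (x *: f) m = x * f m.
Proof. by []. Qed.

Lemma series_sumE I (r : seq I) (F : I -> series K) m :
  (\sum_(k <- r) F k) m = \sum_(k <- r) F k m.
Proof. by apply: (big_morph (fun f : series K => f m)). Qed.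

(* Locked: otherwise unification sees the sum inside it and rewrites there. *)
Definition tmul b i f : series K := locked (fun m =>
  b i * f m + (if (0 < m i)%N then f (msetB m [mset i]) else 0)).

Lemma tmulE b i f m : tmul b i f m =
  b i * f m + (if (0 < m i)%N then f (msetB m [mset i]) else 0).
Proof. by rewrite /tmul -lock. Qed.

(** The series [tvar b i] has only two possibly nonzero coefficients, at [mset0] and at [[mset i]],
    so the convolution collapses to two terms. *)
Lemma smul_tvar b i : smul (tvar b i) = tmul b i.
Proof.
apply/funext => f; apply/funext => m.
have ne0i : (mset0 == [mset i]%mset) = false.
  by apply/negbTE/eqP => /msetP/(_ i); rewrite mset0E msetnxx.
have mB0 : (msetB m mset0 = m)%mset.
  by apply/msetP => a; rewrite msetE2 mset0E subn0.
rewrite tmulE /smul.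
pose s := mset0 :: (if (0 < m i)%N then [:: [mset i]%mset] else [::]).
rewrite (fsum_seq (r := s)).
- rewrite {}/s big_cons /= {1}/tvar eqxx mB0; congr (_ + _).
  case: ifP => _; last by rewrite big_nil.
  by rewrite big_seq1 /tvar eq_sym ne0i eqxx mul1r.
- by rewrite /s; case: ifP => _; rewrite //= inE ne0i.
- move=> l /=; rewrite {}/s inE => /orP[/eqP->|].
    by apply/forallP => -[x /= xS]; rewrite mset0E.
  case: ifP => // mi; rewrite inE => /eqP->; apply/forallP => -[x /= _].
  by rewrite msetnE; case: eqP => // ->.
- move=> l /= lm; rewrite {}/s inE negb_or => /andP[l0 lS].
  rewrite /tvar (negbTE l0); case: eqP => [li|_]; last by rewrite mul0r.
  move: lS lm; rewrite li; case: ifP => [_|mi]; first by rewrite inE eqxx.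
  move=> _ /forallP iP; have iS : i \in finsupp [mset i]%mset.
    by rewrite msuppE in_mset1.
  by have := iP [` iS]%fset; rewrite /= msetnxx mi.
Qed.

Lemma pd_linear i : linear (@pd K i).
Proof.
by move=> x f g; apply/funext => m; rewrite /pd !series_lcombE /=; ring.
Qed.
HB.instance Definition _ i :=
  GRing.isLinear.Build K (series K) (series K) _ (@pd K i) (pd_linear i).

Lemma tmul_linear b i : linear (tmul b i).
Proof.
move=> x f g; apply/funext => m; rewrite series_lcombE !tmulE !series_lcombE.
by case: ifP => _; rewrite ?series_lcombE; ring.
Qed.
HB.instance Definition _ b i :=
  GRing.isLinear.Build K (series K) (series K) _ (tmul b i) (tmul_linear b i).

Definition tmode b (a : int) : op K := fun f =>
  match a with
  | Posz 0 => 0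
  | Posz i.+1 => pd i f
  | Negz i => i.+1%:R *: tmul b i f
  end.

Lemma PmodeE b : @Pmode K b = tmode b.
Proof.
by apply/funext => -[[|i]|i] //; apply/funext => f /=; rewrite smul_tvar.
Qed.

Lemma Pmode_linear b a : linear (@Pmode K b a).
Proof.
rewrite PmodeE => x f g; case: a => [[|i]|i]; cbn [tmode].
  by rewrite scaler0 addr0.
  by rewrite linearP.
by rewrite tmul_linear scalerDr !scalerA mulrC.
Qed.
HB.instance Definition _ b a :=
  GRing.isLinear.Build K (series K) (series K) _ (@Pmode K b a)
    (Pmode_linear b a).

Lemma pdZ i (x : K) f : pd i (x *: f) = x *: pd i f.
Proof. exact: linearZ. Qed.

Lemma tmulZ b i (x : K) f : tmul b i (x *: f) = x *: tmul b i f.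
Proof. exact: linearZ. Qed.

Lemma pd_sone i : pd i (sone K) = 0.
Proof.
apply/funext => m; rewrite /pd /sone; case: eqP => [|_]; last by rewrite mulr0.
by move=> /msetP/(_ i); rewrite msetE2 msetnxx mset0E addn1.
Qed.

Lemma pdC i j f : pd i (pd j f) = pd j (pd i f).
Proof.
apply/funext => m; rewrite /pd !msetE2 !msetnE msetDAC !(eq_sym j).
by case: eqP => [->|_] //; rewrite !addn0 mulrCA.
Qed.

Lemma tmulC b i j f :
  tmul b i (tmul b j f) = tmul b j (tmul b i f).
Proof.
have [->//|/negbTE nij] := eqVneq i j.
have nji : (j == i) = false by rewrite eq_sym.
apply/funext => m.
rewrite !tmulE !msetE2 !msetnE nij nji !subn0.
have -> : msetB (msetB m [mset i]) [mset j] = msetB (msetB m [mset j]) [mset i].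
  by apply/msetP => a; rewrite !msetE2 subnAC.
by case: ifP => _; case: ifP => _; ring.
Qed.

(** The canonical commutation relation; moving the base point adds a scalar to the multiplication
    and so leaves it unchanged. *)
Lemma pd_tmul b i j f :
  pd i (tmul b j f) = tmul b j (pd i f) + (i == j)%:R *: f.
Proof.
apply/funext => m; rewrite series_addE series_scaleE tmulE /pd tmulE.
rewrite !msetE2 !msetnE; have [<-|nij] := eqVneq i j; rewrite ?eqxx.
  rewrite addn1 /= msetDC msetD1K; case: ifP => [mi|/negbT].
    rewrite (msetDC (msetB m _)) msetB1K ?in_mset //.
    by rewrite subn1 prednK // -natr1; ring.
  by rewrite -eqn0Ngt => /eqP->; ring.
rewrite addn0 subn0 mulr0n mul0r addr0; case: ifP => mj; last by ring.
have -> : msetB (msetD m [mset i]) [mset j] = msetD (msetB m [mset j]) [mset i].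
  apply/msetP => a; rewrite !msetE2 !msetnE.
  by have [->|] := eqVneq a i; rewrite ?(negbTE nij); lia.
by ring.
Qed.

(** The relation [P_a, P_c] = a for a + c = 0, and 0 otherwise. The convention P_0 = 0 agrees with
    it because the factor a vanishes there. *)
Lemma Pmode_comm b (a c : int) f :
  Pmode b a (Pmode b c f) =
  Pmode b c (Pmode b a f) + (if a + c == 0 then a%:~R else 0) *: f.
Proof.
rewrite PmodeE; case: a c => [[|i]|i] [[|j]|j]; cbn [tmode];
  rewrite ?linear0 ?scaler0 ?add0r ?if_same ?scale0r //.
- by rewrite pdC addr0.
- rewrite pdZ pd_tmul scalerDr scalerA; congr (_ + _ *: _).
  have -> : (Posz i.+1 + Negz j == 0) = (i == j) by lia.
  by case: eqP => [->|_]; rewrite ?mulr1 ?mulr0.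
- rewrite pdZ pd_tmul scalerDr scalerA -addrA -scalerDl.
  have -> : (Negz i + Posz j.+1 == 0) = (i == j) by lia.
  rewrite (eq_sym j); case: eqP => [->|_].
    by rewrite mulr1 NegzE mulrNz subrr scale0r addr0.
  by rewrite mulr0 addr0 scale0r addr0.
- by rewrite !tmulZ tmulC !scalerA mulrC addr0.
Qed.

Lemma Pmode_sone b a : 0 <= a -> Pmode b a (sone K) = 0.
Proof. by case: a => [[|i]|i] //= _; apply: pd_sone. Qed.

Lemma normal_product2 b (a c : int) f :
  normal_product b [:: a; c] f =
  if (0 < a) && (c <= 0) then Pmode b c (Pmode b a f)
  else Pmode b a (Pmode b c f).
Proof. by rewrite /normal_product /=; do 2![case: ltP => _ /=]. Qed.

Lemma normal_product2_linear b a c : linear (@normal_product K b [:: a; c]).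
Proof.
by move=> x f g; rewrite !normal_product2; case: ifP; rewrite !linearP.
Qed.

(** Normal ordering alters a product of two modes only by a scalar, so both orders have the same
    commutator with P_c. *)
Lemma normal_product2_comm b (a d c : int) f :
  normal_product b [:: a; d] (Pmode b c f) =
  Pmode b c (normal_product b [:: a; d] f)
  + ((if a + c == 0 then a%:~R else 0) *: Pmode b d f
     + (if d + c == 0 then d%:~R else 0) *: Pmode b a f).
Proof.
rewrite !normal_product2; case: ifP => _.
  rewrite (Pmode_comm b a) linearD linearZ /= (Pmode_comm b d c) -addrA.
  by congr (_ + _); rewrite addrC.
by rewrite (Pmode_comm b d) linearD linearZ /= (Pmode_comm b a c) -addrA.
Qed.

Lemma Pmode_negz_eq0 b i f m : b i = 0 -> m i = 0%N -> Pmode b (Negz i) f m = 0.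
Proof.
move=> bi mi; rewrite PmodeE /= series_scaleE tmulE bi mi.
by rewrite mul0r addr0 mulr0.
Qed.

(** A letter below -B can be made outermost, where it multiplies by a time whose base value and
    multiplicity in [m] are both zero. This is the source of local finiteness. *)
Lemma normal_product2_eq0 b (B : nat) (a c : int) f m :
    (forall i, (B <= i)%N -> b i = 0 /\ m i = 0%N) ->
    (a < - B%:Z) || (c < - B%:Z) ->
  normal_product b [:: a; c] f m = 0.
Proof.
move=> vanish.
have Plow (d : int) g : d < - B%:Z -> Pmode b d g m = 0.
  case: d => [i|i]; first by lia.
  by move=> di; have [] := vanish i; first lia; apply: Pmode_negz_eq0.
rewrite normal_product2 => lowac; case: ifP => [/andP[a0 _]|/negbT].
  by apply: Plow; lia.
rewrite negb_and => ac; have [aB|aB] := ltP a (- B%:Z); first exact: Plow.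
(* Here [c] is the low letter and [a] is nonpositive, so the two modes commute. *)
rewrite (Pmode_comm b a c) ifF ?scale0r ?addr0; last by apply/negbTE; lia.
by apply: Plow; lia.
Qed.

(** * Operators whose coefficients depend on finitely many coefficients *)

(** Continuity for coefficientwise convergence, with a finite set [T] uniform in the argument; it
    carries identities from polynomials to all series. *)
Definition finitely_determined (D : op K) :=
  forall m, exists T : seq {mset nat}, forall f g,
    {in T, f =1 g} -> D f m = D g m.

Lemma finitely_determined_pd i : finitely_determined (@pd K i).
Proof.
move=> m; exists [:: msetD m [mset i]] => f g fg.
by rewrite /pd fg ?inE.
Qed.

Lemma finitely_determined_tvar b i : finitely_determined (tmul b i).
Proof.
move=> m; exists [:: m; msetB m [mset i]] => f g fg.
by rewrite !tmulE !fg ?inE ?eqxx ?orbT.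
Qed.

Lemma finitely_determined_comp (A D : op K) :
  finitely_determined A -> finitely_determined D ->
  finitely_determined (A \o D).
Proof.
move=> Afd Dfd m; have [T AT] := Afd m.
suff [T' DT'] : exists T' : seq {mset nat}, forall f g,
    {in T', f =1 g} -> {in T, D f =1 D g}.
  by exists T' => f g fg; apply: AT; apply: DT'.
elim: T {AT} => [|l T [T' IH]]; first by exists [::].
have [Tl DTl] := Dfd l; exists (Tl ++ T') => f g fg k.
rewrite inE => /predU1P[->|kT].
  by apply: DTl => j jT; apply: fg; rewrite mem_cat jT.
by apply: IH kT => j jT; apply: fg; rewrite mem_cat jT orbT.
Qed.

Lemma finitely_determined_lcomb (x : K) (A D : op K) :
  finitely_determined A -> finitely_determined D ->
  finitely_determined (x *: A + D).
Proof.
move=> Afd Dfd m; have [[T AT] [T' DT]] := (Afd m, Dfd m).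
exists (T ++ T') => f g fg.
have fgT : {in T, f =1 g} by move=> j jT; apply: fg; rewrite mem_cat jT.
have fgT' : {in T', f =1 g} by move=> j jT; apply: fg; rewrite mem_cat jT orbT.
by have := AT _ _ fgT; have := DT _ _ fgT' => Ef Eg; congr (x * _ + _).
Qed.

Lemma finitely_determined_sub (A D : op K) :
  finitely_determined A -> finitely_determined D ->
  finitely_determined (A - D).
Proof.
by move=> Afd Dfd; rewrite addrC -scaleN1r; apply: finitely_determined_lcomb.
Qed.

Lemma finitely_determined0 : finitely_determined (0 : op K).
Proof. by move=> m; exists [::]. Qed.

Lemma finitely_determined_sum I (r : seq I) (Q : pred I) (F : I -> op K) :
  (forall k, finitely_determined (F k)) ->
  finitely_determined (\sum_(k <- r | Q k) F k).
Proof.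
move=> Ffd; elim/big_rec: _ => [|k A _ Afd]; first exact: finitely_determined0.
by rewrite -[F k]scale1r; apply: finitely_determined_lcomb.
Qed.

Lemma finitely_determined_Pmode b a : finitely_determined (@Pmode K b a).
Proof.
rewrite PmodeE; case: a => [[|i]|i]; first exact: finitely_determined0.
  exact: finitely_determined_pd.
have := finitely_determined_lcomb i.+1%:R (finitely_determined_tvar b i)
  finitely_determined0.
by rewrite addr0.
Qed.

Lemma finitely_determined_normal_product2 b a c :
  finitely_determined (@normal_product K b [:: a; c]).
Proof.
have PP d e := finitely_determined_comp (finitely_determined_Pmode b d)
  (finitely_determined_Pmode b e).
have -> : @normal_product K b [:: a; c] =
    if (0 < a) && (c <= 0) then Pmode b c \o Pmode b a
    else Pmode b a \o Pmode b c.
  by apply/funext => f; rewrite normal_product2; case: ifP.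
by case: ifP => _; apply: PP.
Qed.

(** * Irreducibility of the Heisenberg action *)

Definition monomial l : series K := fun m => (m == l)%:R.

Lemma seq_mset_cons i s : seq_mset (i :: s) = [mset i] `+` seq_mset s.
Proof.
by apply/msetP => a; rewrite msetE2 !mset_seqE msetnE /= eq_sym; case: eqP.
Qed.

Lemma seq_mset_nil : seq_mset [::] = mset0 :> {mset nat}.
Proof. by apply/msetP => a; rewrite mset_seqE mset0E. Qed.

(** Multiplication by s_i = t_i - b_i builds every monomial from 1, so an operator commuting with
    all [tmul b i] is known on monomials once it is known on 1. *)
Lemma monomial_cons b i l :
  monomial ([mset i] `+` l) = - b i *: monomial l + tmul b i (monomial l).
Proof.
apply/funext => m; rewrite series_lcombE !tmulE mulNr addKr.
rewrite /monomial; case: ifP => mi.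
  congr (nat_of_bool _)%:R; apply/eqP/eqP => [->|<-]; first by rewrite msetD1K.
  by rewrite msetB1K // -mset_gt0.
case: eqP => // mE; move: mi; rewrite mE msetE2 msetnxx; lia.
Qed.

Lemma mset_seqP m : exists s, m = seq_mset s.
Proof. by exists m; rewrite seq_mset_id. Qed.

(* The Heisenberg algebra acts irreducibly, so its commutant is scalar: D maps
   1 to a constant since D(1) is killed by every d/dt_i, hence acts on
   polynomials, and by finite determination on all series, as that constant. *)
Lemma commutant_scalar b (D : op K) :
    linear D -> finitely_determined D ->
    (forall i f, D (pd i f) = pd i (D f)) ->
    (forall i f, D (tmul b i f) = tmul b i (D f)) ->
  forall f, D f = D (sone K) mset0 *: f.
Proof.
move=> Dlin Dfd Dpd Dt; set chi := D (sone K) mset0.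
pose D' : {linear series K -> series K} :=
  HB.pack D (GRing.isLinear.Build K (series K) (series K) _ D Dlin).
have D0 : D 0 = 0 by apply: (linear0 D').
have DZ x f : D (x *: f) = x *: D f by exact: (linearZ_LR D' x f).
have Dsum I (r : seq I) (F : I -> series K) :
    D (\sum_(k <- r) F k) = \sum_(k <- r) D (F k) by apply: (linear_sum D').
have Dmon l : D (monomial l) = chi *: monomial l.
  have [s ->] := mset_seqP l.
  elim: s => [|i s IH].
    rewrite seq_mset_nil; apply/funext => m.
    rewrite series_scaleE /sone /monomial.
    have [[|i s] ->] := mset_seqP m.
      by rewrite seq_mset_nil eqxx mulr1.
    rewrite seq_mset_cons; have -> : [mset i] `+` seq_mset s == mset0 = false.
      by apply/eqP => /msetP/(_ i); rewrite msetE2 msetnxx mset0E.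
    have /(congr1 (fun h : series K => h (seq_mset s))) := Dpd i (sone K).
    rewrite pd_sone D0 /pd => /esym/eqP; rewrite mulf_eq0 pnatr_eq0 /= msetDC.
    by move=> /eqP->; rewrite mulr0.
  rewrite seq_mset_cons (monomial_cons b) Dlin Dt IH tmulZ scalerDr !scalerA.
  by rewrite [chi * _]mulrC.
have Dcst f : D f mset0 = chi * f mset0.
  have [T DT] := Dfd mset0.
  (* A polynomial truncation of [f]: it agrees with [f] on [T], and also at [mset0], the coefficient
     to be read off. *)
  pose g : series K := \sum_(l <- undup (mset0 :: T)) f l *: monomial l.
  have gE l : l \in mset0 :: T -> g l = f l.
    rewrite -mem_undup => lT.
    rewrite /g series_sumE (bigD1_seq l) ?undup_uniq //=.
    rewrite big1 => [|k kl]; last first.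
      by rewrite series_scaleE /monomial eq_sym (negbTE kl) mulr0.
    by rewrite series_scaleE /monomial eqxx mulr1 addr0.
  rewrite (DT f g) => [|l lT]; last by rewrite gE // inE lT orbT.
  have -> : D g = chi *: g.
    rewrite /g Dsum scaler_sumr; apply: eq_bigr => l _.
    by rewrite DZ Dmon !scalerA mulrC.
  by rewrite series_scaleE gE // mem_head.
(* Up to a nonzero integer factor, every other coefficient is the constant term of an iterated
   derivative, and [D] commutes with derivatives. *)
move=> f; apply/funext => m; have [s ->] := mset_seqP m.
rewrite series_scaleE; elim: s f => [|i s IH] f.
  by rewrite seq_mset_nil.
have := IH (pd i f); rewrite Dpd /pd mulrCA seq_mset_cons msetDC.
by apply: mulfI; rewrite pnatr_eq0.
Qed.

End Heisenberg.

(** * Quadratic operators as locally finite sums *)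

Section Quadratic.
Set Implicit Arguments.
Unset Strict Implicit.
Local Open Scope mset_scope.
Local Open Scope ring_scope.
Variables (K : numFieldType) (p : nat) (b : nat -> K).
Hypothesis b_finite : exists N : nat, forall i, (N <= i)%N -> b i = 0.
Implicit Types (f g : series K) (m : {mset nat}) (n a c : int) (N : nat).

Definition quadratic n : op K := op_of b (reduce p (Psymbol2 K (n * p%:Z))).

Definition int_range N : seq int := [seq k%:Z - N%:Z | k <- iota 0 (N + N).+1].

Lemma mem_int_range N a : (a \in int_range N) = (`|a| <= N)%N.
Proof.
apply/mapP/idP => [[k]|aN]; first by rewrite mem_iota => ? ->; lia.
by exists (absz (a + N%:Z)); rewrite ?mem_iota; lia.
Qed.

Lemma int_range_uniq N : uniq (int_range N).
Proof. by rewrite map_inj_uniq ?iota_uniq // => x y; lia. Qed.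

Definition kept a := ~~ (p %| `|a|)%N.

Lemma kept_shift n a : kept (n * p%:Z + a) = kept a.
Proof.
congr (~~ _); change ((p%:Z %| n * p%:Z + a)%Z = (p%:Z %| a)%Z).
by apply: rpredDl; apply: dvdz_mull.
Qed.

Lemma keptN a : kept (- a) = kept a.
Proof. by rewrite /kept abszN. Qed.

Lemma kept_neq0 a : kept a -> a != 0.
Proof. by apply: contra => /eqP->; rewrite dvdn0. Qed.

(** The letters of a word of mode n p sum to n p, so the first determines the second, and either
    both are divisible by p or neither is: testing [a] suffices. *)
Definition quadratic_trunc N n : op K :=
  \sum_(a <- int_range N | kept a) @normal_product K b [:: a; n * p%:Z - a].

Lemma opsumE I (r : seq I) (Q : pred I) (F : I -> op K) f :
  (\sum_(k <- r | Q k) F k) f = \sum_(k <- r | Q k) F k f.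
Proof. by apply: (big_morph (fun D : op K => D f)). Qed.

Lemma quadratic_truncE n m : exists N0, forall N, (N0 <= N)%N ->
  forall f, quadratic n f m = quadratic_trunc N n f m.
Proof.
have [B0 bB] := b_finite; pose M := n * p%:Z.
have [B BP] : exists B : nat, forall i, (B <= i)%N -> b i = 0 /\ m i = 0%N.
  exists (B0 + \max_(i <- m) i.+1)%N => i iB; split; first by apply: bB; lia.
  apply/eqP; rewrite mset_eq0; apply/negP => im.
  have : (i < \max_(j <- m) j.+1)%N by apply: (@leq_bigmax_seq _ m _ succn).
  by lia.
(* If |a| exceeds B + |M|, then [a] or [M - a] lies below -B, and the word contributes nothing to
   the coefficient at [m]. *)
exists (B + absz M)%N => N NB f; rewrite /quadratic /op_of.
rewrite (fsum_seq (r := [seq [:: a; M - a] | a <- int_range N & kept a])) //.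
- rewrite big_map big_filter /quadratic_trunc opsumE.
  rewrite -[in RHS](big_filter _ kept) series_sumE big_filter.
  apply: eq_bigr => a ka; rewrite /reduce /Psymbol2 /has_mode /= andbT.
  have kb : kept (M - a) by rewrite kept_shift keptN.
  rewrite -/(kept a) -/(kept (M - a)) ka kb /= !kept_neq0 //=.
  by rewrite !big_cons big_nil addr0 subrKC eqxx mul1r.
- by rewrite map_inj_uniq ?filter_uniq ?int_range_uniq // => x y [].
- move=> w _ wN; rewrite /reduce; case: ifP => wk; last by rewrite mul0r.
  rewrite /Psymbol2 /has_mode; case: ifP => wm; last by rewrite mul0r.
  case: w => [|a [|c [|d w]]] in wN wk wm *; rewrite ?mul0r // mul1r.
  apply: (normal_product2_eq0 f BP).
  move: wk wm; rewrite /= !big_cons big_nil addr0 andbT.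
  rewrite -/(kept a) => /andP[ka _] /andP[_ /eqP acM].
  have : a \notin int_range N.
    apply: contra wN => aN; apply/mapP; exists a.
      by rewrite mem_filter ka.
    by rewrite /M -acM addrC addKr.
  by rewrite mem_int_range -/M in acM *; lia.
Qed.

Lemma quadratic_truncE_seq n (T : seq {mset nat}) : exists N0, forall N,
  (N0 <= N)%N -> forall f, {in T, quadratic n f =1 quadratic_trunc N n f}.
Proof.
elim: T => [|m T [N0 IH]]; first by exists 0%N.
have [N1 mN1] := quadratic_truncE n m; exists (N0 + N1)%N => N NN f l.
rewrite inE => /predU1P[->|lT]; first by apply: mN1; lia.
by apply: IH lT; lia.
Qed.

Lemma quadratic_trunc_linear N n : linear (quadratic_trunc N n).
Proof.
move=> x f g; rewrite /quadratic_trunc !opsumE scaler_sumr -big_split /=.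
by apply: eq_bigr => a _; rewrite normal_product2_linear.
Qed.

Lemma quadratic_linear n : linear (quadratic n).
Proof.
move=> x f g; apply/funext => m; have [N NE] := quadratic_truncE n m.
by rewrite series_lcombE !(NE _ (leqnn N)) quadratic_trunc_linear.
Qed.
HB.instance Definition _ n :=
  GRing.isLinear.Build K (series K) (series K) _ (quadratic n)
    (quadratic_linear n).

Lemma finitely_determined_quadratic n : finitely_determined (quadratic n).
Proof.
move=> m; have [N NE] := quadratic_truncE n m.
have [|T TE] := @finitely_determined_sum K _ (int_range N) kept
    (fun a => @normal_product K b [:: a; n * p%:Z - a]) _ m.
  by move=> a; apply: finitely_determined_normal_product2.
by exists T => f g fg; rewrite !(NE _ (leqnn N)); apply: TE.
Qed.

Lemma sum_only (V : nmodType) (I : eqType) (r : seq I) (Q : pred I)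
    (F : I -> V) (i : I) :
    uniq r -> i \in r -> (forall j, j != i -> F j = 0) ->
  \sum_(j <- r | Q j) F j = if Q i then F i else 0.
Proof.
move=> ur ir F0; rewrite big_mkcond (bigD1_seq i) //= big1 ?addr0 // => j ji.
by rewrite F0 // if_same.
Qed.

(** * Commutators of quadratic operators with modes *)

Definition ad_coef c : K := if kept c then - (2%:R * c%:~R) else 0.

(** Only a = -c and a = n p + c contribute, each giving -c P_(np+c); the bound on N keeps both in
    range. They come from separate sums, so both count even when they coincide. *)
Lemma quadratic_trunc_Pmode N n c f :
    (absz c + absz (n * p%:Z)%R <= N)%N ->
  quadratic_trunc N n (Pmode b c f) =
  Pmode b c (quadratic_trunc N n f)
  + ad_coef c *: Pmode b (n * p%:Z + c) f.
Proof.
move=> cN; rewrite /quadratic_trunc !opsumE linear_sum /=.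
under eq_bigr do rewrite normal_product2_comm.
rewrite big_split /= big_split /=; congr (_ + _).
have cR : - c \in int_range N by rewrite mem_int_range; lia.
have ncR : n * p%:Z + c \in int_range N by rewrite mem_int_range; lia.
rewrite (sum_only _ (int_range_uniq N) cR); last first.
  by move=> a ac; rewrite ifF ?scale0r //; apply/negbTE; lia.
rewrite (sum_only _ (int_range_uniq N) ncR); last first.
  by move=> a ac; rewrite ifF ?scale0r //; apply/negbTE; lia.
rewrite keptN kept_shift /ad_coef.
case: (kept c); last by rewrite scale0r addr0.
rewrite addNr eqxx opprK ifT; last by lia.
rewrite -scalerDl; congr (_ *: _).
have -> : n * p%:Z - (n * p%:Z + c) = - c by lia.
by rewrite !mulrNz; ring.
Qed.

Lemma quadratic_Pmode n c f :
  quadratic n (Pmode b c f) =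
  Pmode b c (quadratic n f)
  + ad_coef c *: Pmode b (n * p%:Z + c) f.
Proof.
apply/funext => m; have [T TE] := finitely_determined_Pmode b c m.
(* The truncation has to be exact at [m] and also on [T], the coefficients that the outer P_c reads
   to produce the one at [m]. *)
have [N0 NE] := quadratic_truncE_seq n (m :: T).
pose N := (N0 + (absz c + absz (n * p%:Z)%R))%N.
have N0N : (N0 <= N)%N by lia.
rewrite (NE N N0N) ?mem_head // quadratic_trunc_Pmode; last by lia.
congr (_ + _); apply: TE => l lT.
by rewrite (NE N N0N) // inE lT orbT.
Qed.

(** Two letters with nonnegative sum include a nonnegative one, and in the normal product such a
    letter acts first, killing 1. *)
Lemma quadratic_sone n : 0 <= n -> quadratic n (sone K) = 0.
Proof.
move=> n0; have M0 : 0 <= n * p%:Z by rewrite mulr_ge0.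
apply/funext => m; have [N NE] := quadratic_truncE n m.
rewrite (NE _ (leqnn N)) /quadratic_trunc opsumE big1 // => a _.
rewrite normal_product2; case: ifPn => [/andP[a0 _]|].
  by rewrite Pmode_sone ?linear0 // ltW.
by move=> ac; rewrite (@Pmode_sone _ _ (_ - _)) ?linear0 //; lia.
Qed.

(** * Virasoro relations up to a scalar *)

Definition virasoro_defect (m n : int) : op K :=
  bracket (quadratic m) (quadratic n)
  - ((2 * p)%:R * (m - n)%:~R) *: quadratic (m + n).

Lemma virasoro_defectE (m n : int) f : virasoro_defect m n f =
  quadratic m (quadratic n f) - quadratic n (quadratic m f)
  - ((2 * p)%:R * (m - n)%:~R) *: quadratic (m + n) f.
Proof. by []. Qed.

Lemma virasoro_defect_linear (m n : int) : linear (virasoro_defect m n).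
Proof.
move=> x f g; rewrite !virasoro_defectE !quadratic_linear.
by apply/funext => k; rewrite !(series_addE, series_oppE, series_scaleE); ring.
Qed.

Lemma finitely_determined_virasoro_defect (m n : int) :
  finitely_determined (virasoro_defect m n).
Proof.
have qfd := finitely_determined_quadratic.
apply: finitely_determined_sub.
  by apply: finitely_determined_sub; apply: finitely_determined_comp.
rewrite -[X in finitely_determined X]addr0.
exact: finitely_determined_lcomb (qfd _) (@finitely_determined0 K).
Qed.

Lemma virasoro_defect_Pmode (m n : int) c f :
  virasoro_defect m n (Pmode b c f) = Pmode b c (virasoro_defect m n f).
Proof.
(* The two middle terms are exchanged when u and v are, so they cancel in the commutator. What
   remains is balanced by [ad_coef c] times the difference of [ad_coef] at n p + c and m p + c,
   which is 2p(m-n) [ad_coef c]. *)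
have qq (u v : int) : quadratic u (quadratic v (Pmode b c f)) =
    Pmode b c (quadratic u (quadratic v f))
    + ad_coef c *: Pmode b (u * p%:Z + c) (quadratic v f)
    + ad_coef c *: Pmode b (v * p%:Z + c) (quadratic u f)
    + (ad_coef c * ad_coef (v * p%:Z + c)) *: Pmode b ((u + v) * p%:Z + c) f.
  rewrite quadratic_Pmode linearD linearZ /= !quadratic_Pmode scalerDr scalerA.
  by rewrite !addrA mulrDl.
have linP (x : K) u v w : Pmode b c (u - v - x *: w) =
    Pmode b c u - Pmode b c v - x *: Pmode b c w.
  by rewrite !linearB linearZ_LR.
rewrite !virasoro_defectE linP (qq m n) (qq n m) quadratic_Pmode (addrC n m).
apply/funext => k; rewrite !(series_addE, series_oppE, series_scaleE).
have adE (v : int) : ad_coef (v * p%:Z + c) =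
    if kept c then - (2%:R * (v%:~R * p%:R + c%:~R)) else 0.
  by rewrite /ad_coef kept_shift intrD intrM -!pmulrn.
rewrite !adE /ad_coef intrB natrM.
by case: (kept c); ring.
Qed.

(** The scalar is the constant term of the defect applied to 1. No closed formula for it is
    computed: an eigenvector will determine it. *)
Lemma quadratic_bracket (m n : int) : exists2 chi : K,
  forall f, bracket (quadratic m) (quadratic n) f =
    ((2 * p)%:R * (m - n)%:~R) *: quadratic (m + n) f + chi *: f &
  0 <= m -> 0 <= n -> chi = 0.
Proof.
exists (virasoro_defect m n (sone K) mset0) => [f|m0 n0]; last first.
  rewrite virasoro_defectE !quadratic_sone ?addr_ge0 // !linear0.
  by rewrite !addr0.
have defZ (x : K) g : virasoro_defect m n (x *: g) = x *: virasoro_defect m n g.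
  have := virasoro_defect_linear m n x g 0.
  have -> : virasoro_defect m n 0 = 0.
    by rewrite virasoro_defectE !linear0 !addr0.
  by rewrite !addr0.
suff <- : virasoro_defect m n f = virasoro_defect m n (sone K) mset0 *: f.
  by rewrite virasoro_defectE addrC subrK.
apply: (@commutant_scalar K b).
- exact: virasoro_defect_linear.
- exact: finitely_determined_virasoro_defect.
- by move=> i g; apply: (virasoro_defect_Pmode m n i.+1%:Z).
- move=> i g; have := virasoro_defect_Pmode m n (Negz i) g.
  by rewrite PmodeE /= defZ; apply: scalerI; rewrite pnatr_eq0.
Qed.

(** * Shifted operators and their linear independence *)

Variable c : int -> K.

Definition centered n : op K := quadratic n - c n *: idfun.

Lemma centeredE n f : centered n f = quadratic n f - c n *: f.
Proof. by []. Qed.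

Lemma centered_Pmode n a f :
  centered n (Pmode b a f) =
  Pmode b a (centered n f) + ad_coef a *: Pmode b (n * p%:Z + a) f.
Proof.
have PB (x : K) u v : Pmode b a (u - x *: v) = Pmode b a u - x *: Pmode b a v.
  by rewrite linearB linearZ_LR.
by rewrite !centeredE quadratic_Pmode PB addrAC.
Qed.

(** Commuting a vanishing combination with one mode removes the constants and leaves a combination
    of derivatives in distinct times. For p = 1 no index is kept and every [quadratic] operator is
    zero. *)
Lemma centered_independent : (1 < p)%N -> independent_from_m1 centered.
Proof.
move=> p1 N x; set A := \sum_(j < N) _ => A0 j0.
have AE f : \sum_(j < N) x j *: centered (j%:Z - 1) f = 0.
  have := congr1 (fun D : op K => D f) A0.
  by rewrite /A opsumE => S; exact: S.
(* With a = p + 1 the shifted modes are P_(jp+1), derivatives even for j = 0, that is n = -1. The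
   monomial [f] is the time of index [j0 * p], that is s_(j0 p + 1), which singles out j = j0. *)
pose a := p.+1%:Z; pose f := @monomial K [mset (j0 * p)%N].
have ka : kept a by rewrite /kept /a /= -addn1 dvdn_addr // gtnNdvd.
have := AE (Pmode b a f).
under eq_bigr do rewrite centered_Pmode scalerDr -linearZ_LR.
rewrite big_split /= -linear_sum AE linear0 add0r => S0.
have PE (j : 'I_N) : Pmode b ((j%:Z - 1) * p%:Z + a) f mset0 = (j == j0)%:R.
  have -> : (j%:Z - 1) * p%:Z + a = (j * p)%N.+1%:Z.
    by rewrite mulrBl mul1r /a -PoszM; lia.
  rewrite /= /pd mset0E mul1r mset0D /f /monomial; congr (nat_of_bool _)%:R.
  apply/eqP/eqP => [/msetP/(_ (j * p)%N)|->//].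
  rewrite msetnxx msetnE; case: eqP => // /eqP.
  by rewrite eqn_pmul2r ?(ltnW p1) // => /eqP /val_inj.
have := congr1 (fun g : series K => g mset0) S0.
rewrite series_sumE (bigD1 j0) //= big1 => [|j jj0]; last first.
  by rewrite !series_scaleE PE (negbTE jj0) !mulr0.
rewrite addr0 !series_scaleE PE eqxx mulr1 /ad_coef ka => /eqP.
by rewrite mulf_eq0 oppr_eq0 mulf_eq0 !(pnatr_eq0, intr_eq0) orbF => /eqP.
Qed.

(** * Removal of the central term by a common eigenvector *)

Variable tau : series K.
Hypothesis p_gt0 : (0 < p)%N.
Hypothesis tau_neq0 : tau != 0.
Hypothesis c_eigen : forall n, -1 <= n -> quadratic n tau = c n *: tau.

Lemma bracketE (A D : op K) f : bracket A D f = A (D f) - D (A f).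
Proof. by []. Qed.

Lemma quadraticZ n (x : K) f : quadratic n (x *: f) = x *: quadratic n f.
Proof. exact: linearZ_LR. Qed.

(** On [tau] the commutator vanishes, since both operators act there as scalars; the bound on m + n
    makes c_(m+n) an eigenvalue too. *)
Lemma central_charge (m n : int) (chi : K) :
    -1 <= m -> -1 <= n -> -1 <= m + n ->
    (forall f, bracket (quadratic m) (quadratic n) f =
      ((2 * p)%:R * (m - n)%:~R) *: quadratic (m + n) f + chi *: f) ->
  chi = - ((2 * p)%:R * (m - n)%:~R * c (m + n)).
Proof.
move=> m1 n1 mn1 /(_ tau); rewrite bracketE !(c_eigen, quadraticZ) //.
rewrite !scalerA -scalerDl mulrC subrr => /esym/eqP.
by rewrite scaler_eq0 (negbTE tau_neq0) orbF addrC addr_eq0 => /eqP.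
Qed.

(** Needed for membership: the generators with positive mode have no constant subtracted. *)
Lemma eigenvalue_eq0 n : 0 < n -> c n = 0.
Proof.
move=> n0; have [chi brE chi0] := quadratic_bracket n 0.
have n1 : -1 <= n by lia.
have n01 : -1 <= n + 0 by lia.
have := central_charge n1 (isT : -1 <= 0 :> int) n01 brE.
rewrite (chi0 (ltW n0) (lexx 0)) subr0 => /esym/eqP.
rewrite oppr_eq0 !mulf_eq0 pnatr_eq0 intr_eq0.
by rewrite muln_eq0 /= -leqn0 leqNgt p_gt0 gt_eqF //= => /eqP.
Qed.

Lemma centered_bracket (m n : int) : -1 <= m -> -1 <= n ->
  forall f, bracket (centered m) (centered n) f =
    ((2 * p)%:R * (m - n)%:~R) *: centered (m + n) f.
Proof.
move=> m1 n1 f.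
have -> : bracket (centered m) (centered n) f =
    bracket (quadratic m) (quadratic n) f.
  have qB k (x : K) u v : quadratic k (u - x *: v) =
      quadratic k u - x *: quadratic k v by rewrite linearB linearZ_LR.
  rewrite !bracketE !centeredE !qB.
  apply/funext => k.
  by rewrite !(series_addE, series_oppE, series_scaleE); ring.
have [mn|mn] := leP (-1) (m + n); last first.
  (* Below -1 only m = n = -1 occurs, where both sides are zero. *)
  have -> : n = m by lia.
  by rewrite bracketE !subrr mulr0 scale0r.
have [chi brE _] := quadratic_bracket m n.
rewrite brE (central_charge m1 n1 mn brE) centeredE scalerBr scalerA.
by rewrite scaleNr.
Qed.

(** The factor 1/(2p) absorbs the 2 from the unhalved quadratic expression and the p from modes
    spaced by p. *)
Lemma centered_virasoro :
  centerless_virasoro (fun n => (2 * p)%:R^-1 *: centered n).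
Proof.
move=> m n m1 n1; apply/funext => f.
have cZ k (x : K) g : centered k (x *: g) = x *: centered k g.
  by rewrite !centeredE quadraticZ scalerBr !scalerA mulrC.
have opZ (x : K) (A : op K) g : (x *: A) g = x *: A g by [].
rewrite bracketE !opZ !cZ !scalerA -scalerBr -bracketE centered_bracket //.
rewrite !scalerA; congr (_ *: _); field.
by rewrite pnatr_eq0 -lt0n.
Qed.

End Quadratic.

(** * Application to the tau function *)

Theorem corollary4p10 (K : numFieldType) (p : nat) (hp : (0 < p)%N)
    (b : nat -> K) (hb : exists N : nat, forall i, (N <= i)%N -> b i = 0)
    (L LV Phi PhiV : psd K) (tau : series K)
    (hL : is_lax L) (hLV : pinverse L LV)
    (hKP : KP_hierarchy L) (hred : reduced p L)
    (hPhi : dressing_of Phi PhiV L)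
    (hstring : string_equation p b Phi PhiV L LV)
    (htau : is_tau Phi tau)
    (P : nat -> int -> symbol K) (hP : is_P_family P)
    (c : int -> nat -> K)
    (hc : forall (k : int) (i : nat), -1 <= k -> (0 < i)%N ->
      Pbar p b P i k tau = c k i *: tau) :
  let V (n : int) : op K := Pbar p b P 2%N n - c n 2%N *: idfun in
  [/\ forall n : int, -1 <= n -> P_algebra p b P c (V n),
      centerless_virasoro (fun n => (2 * p)%:R^-1 *: V n) &
      (1 < p)%N -> independent_from_m1 V].
Proof.
move=> V; have [_ P2 _ _ _] := hP; have [/eqP tau0 _] := htau.
have qE n : Pbar p b P 2%N n = quadratic p b n by rewrite /Pbar P2.
pose c2 n := c n 2%N.
have eigen n : -1 <= n -> quadratic p b n tau = c2 n *: tau.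
  by move=> n1; rewrite -qE; exact: hc.
have -> : V = centered p b c2.
  by apply/funext => n; rewrite /V qE.
split.
(* Each [V n] is itself one of the generators, so it lies in every Lie-closed set containing
   them. *)
- move=> n n1 G [_ sG]; apply: sG; exists 2%N; split=> //.
  have VE : centered p b c2 n = Pbar p b P 2%N n - c n 2%N *: idfun.
    by rewrite qE.
  have [->|nm1] := eqVneq n (-1); first by constructor 1; rewrite qE.
  have [->|n0] := eqVneq n 0; first by constructor 2; rewrite qE.
  have npos : 0 < n by lia.
  constructor 3; exists (absz n); split; first by lia.
  rewrite VE (_ : c n 2%N = 0) ?scale0r ?subr0 ?gtz0_abs //.
  exact: (eigenvalue_eq0 hb hp tau0 eigen).
- exact: (centered_virasoro hb hp tau0 eigen).
- exact: centered_independent.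
Qed.
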